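(* Let $G$ and $H$ be two balanced simple graphs without isolated vertices on the same vertex set $V$, with the same set $V_i$ of degree-$i$ vertices for every $i$ and with the same joint degree matrix. Then there is a finite sequence of restricted swap operations transforming $G$ into a graph $G'$ such that $\mathbf{s}_{G'}(v)=\mathbf{s}_H(v)$ for every $v\in V$.
   Context: The joint degree matrix has entries $\mathcal{J}_{ij}=|\{xy\in E: x\in V_i,y\in V_j\}|$. Set $A_j(j)=2\mathcal{J}_{jj}/|V_j|$ and $A_j(i)=\mathcal{J}_{ij}/|V_j|$ for $i\ne j$. The degree spectrum $\mathbf{s}_G(v)$ is the vector whose $i$-th component is the number of neighbors of $v$ of degree $i$. A graph is balanced if for all $j$, all $v\in V_j$ and all $i$, $\mathbf{s}_G(v)_i\in\{\lfloor A_j(i)\rfloor,\lceil A_j(i)\rceil\}$. A swap $ac,bd\Rightarrow bc,ad$ applies to distinct vertices with $ac,bd\in E$ and $bc,ad\notin E$ and replaces $E$ by $(E\setminus\{ac,bd\})\cup\{bc,ad\}$; a restricted swap operation (RSO) is such a swap where $a$ and $b$ have the same degree. *)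

(* Defs.v *)
From mathcomp Require Import all_boot all_order all_algebra.

Set Implicit Arguments.
Unset Strict Implicit.
Unset Printing Implicit Defensive.

Import Order.TTheory GRing.Theory Num.Theory.

(* A simple graph on the vertex set [V]: its edges are 2-element sets. *)
Record sgraph (V : finType) := SGraph {
  edges : {set {set V}};
  edges_simple : [forall e in edges, #|e| == 2]
}.

Section SimpleGraphs.

Variable V : finType.
Implicit Types (G : sgraph V) (v a b c d : V) (i j : nat).

(* [[set u; u]] is a singleton, hence never an edge. *)
Definition adj G u v : bool := [set u; v] \in edges G.

Definition neighbors G v : {set V} := [set u | adj G v u].

Definition deg G v : nat := #|neighbors G v|.

Definition deg_class G i : {set V} := [set v | deg G v == i].

Definition no_isolated G : Prop := forall v, 0 < deg G v.

(* Edges are counted unordered, so each edge inside V_i counts once in the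
   diagonal entry. *)
Definition jdm G i j : nat :=
  #|[set e in edges G |
      [exists x in deg_class G i, exists y in deg_class G j,
         e == [set x; y]]]|.

(* [avg_deg G j i] is A_j(i). Division by zero occurs only for empty V_j,
   where the value is never used by [balanced]. *)
Definition avg_deg G j i : rat :=
  ((if i == j then 2 * jdm G j j else jdm G i j)%N%:R / #|deg_class G j|%:R)%R.

Definition spectrum G v i : nat := #|[set u in neighbors G v | deg G u == i]|.

Definition balanced G : Prop :=
  forall j v, v \in deg_class G j -> forall i,
    (spectrum G v i)%:Z%R = Num.floor (avg_deg G j i) \/
    (spectrum G v i)%:Z%R = Num.ceil (avg_deg G j i).

(* The swap ac, bd => bc, ad turns [G] into [G']. *)
Definition is_swap a b c d G G' : bool :=
  [&& uniq [:: a; b; c; d],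
      adj G a c, adj G b d, ~~ adj G b c, ~~ adj G a d
    & edges G' == (edges G :\: [set [set a; c]; [set b; d]])
                    :|: [set [set b; c]; [set a; d]]].

Definition rso : rel (sgraph V) := fun G G' =>
  [exists a, exists b, exists c, exists d,
     (deg G a == deg G b) && is_swap a b c d G G'].

End SimpleGraphs.

(* Main.v *)
Require Import Defs.
From mathcomp Require Import all_boot all_order all_algebra.
From mathcomp Require Import fingroup perm zify.

(** The spectra of a balanced graph form a matrix [V x degrees] whose entries,
    within one degree class and one column, take two consecutive values, so
    they behave like a 0/1 matrix.  Its row sums are the degrees and its column
    sums over a degree class are given by the joint degree matrix, so they agree
    for [G] and [H].  Whenever [v] and [w] have the same degree, [v] has more
    neighbours of degree [i] than [w] and [w] more of degree [k] than [v], some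
    RSO exchanges the entries of [v] and [w] in columns [i] and [k]; such
    exchanges are reversible, so both matrices may be moved towards each other.
    The rows are made equal one at a time: if row [v] differs in columns [i] and
    [k], equality of the column sums yields a row [w], not treated yet, with
    which an exchange in one of the two matrices corrects both entries. *)

Set Implicit Arguments.
Unset Strict Implicit.
Unset Printing Implicit Defensive.

(** * Exchanges in two-valued matrices *)

Section Exchange.

Variables V I : finType.
Implicit Types (M N : V -> I -> nat) (P : {set V}) (u v w : V) (i k l : I).

(** Transposing entries, rather than shifting them by one, avoids truncated subtraction and makes
    the operation an involution. *)
Definition exchange M v w i k : V -> I -> nat :=
  fun u l => if (l == i) || (l == k) then M (tperm v w u) l else M u l.

Lemma exchangeK M v w i k u l :
  exchange (exchange M v w i k) v w i k u l = M u l.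
Proof. by rewrite /exchange; case: (_ || _) => //; rewrite tpermK. Qed.

Variables (delta : V -> nat) (f : nat -> I -> nat).

(** Unit differences turn the transposition into a transfer of one unit within each of the two rows,
    which preserves row sums. In a two-valued matrix strict inequalities already force them. *)
Definition exchangeable M v w i k :=
  [/\ delta v = delta w, M v i = (M w i).+1 & M w k = (M v k).+1].

Definition two_valued M :=
  forall v i, f (delta v) i <= M v i <= (f (delta v) i).+1.

Definition same_row_sums M N :=
  forall v, \sum_i M v i = \sum_i N v i.

Definition same_column_sums M N :=
  forall j i, \sum_(v | delta v == j) M v i = \sum_(v | delta v == j) N v i.

Lemma exchangeable_neq M v w i k : exchangeable M v w i k -> v != w /\ i != k.
Proof.
case=> _ Mi Mk; split; apply/eqP => E; first by rewrite E in Mi; lia.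
by rewrite E in Mi; lia.
Qed.

Lemma exchangeable_exchange M v w i k :
  exchangeable M v w i k -> exchangeable (exchange M v w i k) v w k i.
Proof.
case=> dvw Mi Mk; split=> //; rewrite /exchange !eqxx ?orbT tpermL tpermR //.
Qed.

Lemma delta_tperm v w u : delta v = delta w -> delta (tperm v w u) = delta u.
Proof. by move=> dvw; case: tpermP => // ->. Qed.

Lemma exchange_two_valued M v w i k :
  delta v = delta w -> two_valued M -> two_valued (exchange M v w i k).
Proof.
move=> dvw bM u l; rewrite /exchange; case: ifP => // _.
by have := bM (tperm v w u) l; rewrite delta_tperm.
Qed.

Lemma exchange_column_sums M v w i k :
  delta v = delta w -> same_column_sums (exchange M v w i k) M.
Proof.
move=> dvw j l; rewrite /exchange; case: ((l == i) || (l == k)) => //.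
symmetry; rewrite (reindex_inj (@perm_inj _ (tperm v w))) /=.
by apply: eq_bigl => u; rewrite delta_tperm.
Qed.

Lemma exchange_row_sums M v w i k :
  exchangeable M v w i k -> same_row_sums (exchange M v w i k) M.
Proof.
move=> ex; have [vw ik] := exchangeable_neq ex; case: ex => _ Mi Mk u.
have ki : k != i by rewrite eq_sym.
rewrite (bigD1 i) //= (bigD1 k) //= [RHS](bigD1 i) //= [in RHS](bigD1 k) //=.
rewrite (eq_bigr (M u)); last first.
  by move=> l /andP[li lk]; rewrite /exchange (negbTE li) (negbTE lk).
rewrite !addnA; congr (_ + _); rewrite /exchange !eqxx ?orbT /=.
by case: tpermP => [->|->|_ _] //; lia.
Qed.

Lemma exchange_off M v w i k u l :
  u != v -> u != w -> exchange M v w i k u l = M u l.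
Proof.
by move=> uv uw; rewrite /exchange; case: ifP => // _; rewrite tpermD // eq_sym.
Qed.

(* [reach] is an arbitrary relation: it is instantiated by reachability through
   RSOs, which makes sense only for matrices that are spectra of graphs. *)
Variable reach : (V -> I -> nat) -> (V -> I -> nat) -> Prop.
Hypothesis reach_eq : forall M N, (forall v i, M v i = N v i) -> reach M N.
Hypothesis reach_trans : forall M N L, reach M N -> reach N L -> reach M L.
Hypothesis reach_exchange : forall M v w i k,
  exchangeable M v w i k -> reach M (exchange M v w i k).

(** After an exchange, the same rows are exchangeable with [i] and [k] interchanged. This second
    exchange restores [M] only pointwise, hence the appeal to [reach_eq]. *)
Lemma reach_unexchange M v w i k :
  exchangeable M v w i k -> reach (exchange M v w i k) M.
Proof.
move=> ex; apply: reach_trans (reach_exchange (exchangeable_exchange ex)) _.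
apply: reach_eq => u l; rewrite -[RHS](exchangeK M v w i k).
by rewrite {1 3}/exchange orbC.
Qed.

Record compatible M N : Prop := Compatible {
  compatible_l : two_valued M;
  compatible_r : two_valued N;
  compatible_rows : same_row_sums M N;
  compatible_columns : same_column_sums M N }.

Lemma compatible_sym M N : compatible M N -> compatible N M.
Proof. by case=> bM bN r c; split. Qed.

Lemma compatible_exchange M N v w i k :
  exchangeable M v w i k -> compatible M N ->
  compatible (exchange M v w i k) N.
Proof.
move=> ex [bM bN rMN cMN]; have [dvw _ _] := ex; split=> //.
- exact: exchange_two_valued.
- by move=> u; rewrite exchange_row_sums.
- by move=> j l; rewrite exchange_column_sums.
Qed.

Lemma row_sums_lt M N v i :
  same_row_sums M N -> M v i != N v i -> exists k, M v k < N v k.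
Proof.
move=> rMN ni; apply/existsP; apply: contraT; rewrite negb_exists.
move=> /forallP H; have /eqP : \sum_l M v l = \sum_l N v l by apply: rMN.
rewrite (bigD1 i) //= [X in _ == X](bigD1 i) //=.
have le : \sum_(l | l != i) N v l <= \sum_(l | l != i) M v l.
  by apply: leq_sum => l _; rewrite leqNgt.
by have := H i; lia.
Qed.

(* Otherwise [M w k + N w i <= M w i + N w k] for all [w] in the class of [v],
   strictly for [v], which contradicts the equality of the column sums. *)
Lemma exchange_partner P M N v i k :
  compatible M N -> (forall u l, u \in P -> M u l = N u l) ->
  N v i < M v i -> M v k < N v k ->
  exists2 w, w \notin P &
    exchangeable M v w i k \/ exchangeable N v w k i.
Proof.
move=> [bM bN _ cMN] eqP_ lti ltk.
have Hb u l : delta u = delta v ->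
    (f (delta v) l <= M u l <= (f (delta v) l).+1) /\
    (f (delta v) l <= N u l <= (f (delta v) l).+1).
  by move=> <-.
pose good w := [&& w \notin P, delta w == delta v &
  (M w i < M v i) && (M v k < M w k) || (N v i < N w i) && (N w k < N v k)].
have [w|none] := pickP good.
  case/and3P => wP /eqP dw H; exists w => //.
  have := Hb w i dw; have := Hb w k dw.
  have := Hb v i erefl; have := Hb v k erefl.
  by case/orP: H => /andP[H1 H2]; [left|right]; split; rewrite ?dw //; lia.
have le w : delta w == delta v -> M w k + N w i <= M w i + N w k.
  move=> /eqP dw; have [wP|wP] := boolP (w \in P).
    by rewrite !eqP_ // addnC.
  have := none w; rewrite /good wP dw eqxx /=.
  have := Hb w i dw; have := Hb w k dw.
  have := Hb v i erefl; have := Hb v k erefl.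
  by lia.
have : \sum_(w | delta w == delta v) (M w k + N w i) <
       \sum_(w | delta w == delta v) (M w i + N w k).
  rewrite (bigD1 v) //= [X in _ < X](bigD1 v) //=.
  have : \sum_(w | (delta w == delta v) && (w != v)) (M w k + N w i) <=
         \sum_(w | (delta w == delta v) && (w != v)) (M w i + N w k).
    by apply: leq_sum => w /andP[/le].
  by lia.
by rewrite !big_split /= !cMN addnC ltnn.
Qed.

Lemma exchange_diff M N v w i k :
  exchangeable M v w i k -> M w i = N v i -> M w k = N v k ->
  #|[set l | exchange M v w i k v l != N v l]| < #|[set l | M v l != N v l]|.
Proof.
move=> [_ Mi Mk] Ni Nk; apply: proper_card; apply/properP; split.
  apply/subsetP => l; rewrite !inE /exchange tpermL.
  case: (eqVneq l i) => [->|_] /=; first by rewrite Ni eqxx.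
  by case: (eqVneq l k) => [->|_] //=; rewrite Nk eqxx.
by exists i; rewrite !inE ?/exchange ?eqxx ?tpermL ?Ni ?eqxx //; lia.
Qed.

(** Induction on the number of columns where the two rows [v] differ. Exchanges made in [N] are
    later run backwards, whence [reach N' N]. Partners lie outside [P], so settled rows stay
    equal. *)
Lemma equalize_row P v M N :
  v \notin P -> compatible M N -> (forall u l, u \in P -> M u l = N u l) ->
  exists M' N', [/\ reach M M', reach N' N, compatible M' N' &
    forall u l, u \in v |: P -> M' u l = N' u l].
Proof.
move=> vP; have [n] := ubnP #|[set l | M v l != N v l]|.
elim: n M N => // n IHn M N len cMN eqMN.
have [i ni|eqv] := pickP (fun l => M v l != N v l); last first.
  exists M, N; split=> //; try exact: reach_eq.
  by move=> u l /setU1P[->|/eqMN //]; apply/eqP; rewrite -[_ == _]negbK eqv.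
have [k ltk] := row_sums_lt (compatible_rows cMN) ni.
(* The first [i] may have the wrong sign; equal row sums also provide a column where [M] exceeds
   [N]. *)
have [{ni}i lti] : exists i, N v i < M v i.
  apply: (@row_sums_lt _ _ v i); last by rewrite eq_sym.
  exact: compatible_rows (compatible_sym cMN).
have [w wP ex] := exchange_partner cMN eqMN lti ltk.
have offP u : u \in P -> (u != v) && (u != w).
  by move=> uP; apply/andP; split; apply: contraTneq uP => ->.
have [bM bN _ _] := cMN.
have Hb l : delta v = delta w ->
    (f (delta v) l <= M w l <= (f (delta v) l).+1) /\
    (f (delta v) l <= N w l <= (f (delta v) l).+1).
  by move=> ->.
(* With two consecutive values per column, the strict inequalities at [v] fix all entries involved:
   row [w] of the matrix to be exchanged holds exactly the values that row [v] has in the other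
   matrix. *)
have := bM v i; have := bN v i; have := bM v k; have := bN v k.
case: ex => ex Nk Mk Ni Mi; have [dvw e1 e2] := ex;
  have := Hb i dvw; have := Hb k dvw => Hk Hi.
- have [|||M' [N' [r1 r2 c e]]] := IHn (exchange M v w i k) N.
  + apply: leq_trans (exchange_diff ex _ _) _; try lia.
  + exact: compatible_exchange.
  + by move=> u l uP; have /andP[? ?] := offP u uP; rewrite exchange_off ?eqMN.
  exists M', N'; split=> //; exact: reach_trans (reach_exchange ex) r1.
- have [|||M' [N' [r1 r2 c e]]] := IHn M (exchange N v w k i).
  + have sw (A B : V -> I -> nat) :
        [set l | A v l != B v l] = [set l | B v l != A v l].
      by apply/setP => l; rewrite !inE eq_sym.
    rewrite sw; apply: leq_trans (exchange_diff ex _ _) _; try lia.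
    by rewrite sw; lia.
  + by apply: compatible_sym; apply: compatible_exchange => //;
       apply: compatible_sym.
  + by move=> u l uP; have /andP[? ?] := offP u uP; rewrite exchange_off ?eqMN.
  exists M', N'; split=> //; exact: reach_trans r2 (reach_unexchange ex).
Qed.

Lemma compatible_reach M N : compatible M N -> reach M N.
Proof.
suff gen P : compatible M N -> (forall u l, u \in P -> M u l = N u l) ->
    reach M N.
  by move=> c; apply: (gen set0) => // u l; rewrite inE.
have [n] := ubnP #|~: P|.
elim: n P M N => // n IHn P M N lenP c e.
have [v vP|full] := pickP [pred v | v \notin P]; last first.
  by apply: reach_eq => v l; apply: e; rewrite -[_ \in _]negbK; have /= -> := full v.
have [M' [N' [r1 r2 c' e']]] := equalize_row vP c e.
apply: reach_trans r1 (reach_trans _ r2); apply: (IHn (v |: P)) => //.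
rewrite -ltnS; apply: leq_trans lenP; rewrite ltnS setCU; apply: proper_card.
apply/properP; split; first exact: subsetIr.
by exists v; rewrite !inE ?eqxx.
Qed.

End Exchange.

(** * Restricted swaps *)

Section Graphs.

Variable V : finType.
Implicit Types (G H : sgraph V) (a b c d u v w x y : V).

Lemma adj_sym G x y : adj G x y = adj G y x.
Proof. by rewrite /adj setUC. Qed.

Lemma adj_irr G x : adj G x x = false.
Proof.
apply: negbTE; apply/negP => xx; have /forall_inP/(_ _ xx) := edges_simple G.
by rewrite setUid cards1.
Qed.

Lemma spectrumE G v i : spectrum G v i = \sum_y adj G v y * (deg G y == i).
Proof.
rewrite /spectrum -sum1_card big_mkcond; apply: eq_bigr => y _.
by rewrite !inE mulnb; case: (_ && _).
Qed.

Lemma degE G v : deg G v = \sum_y adj G v y.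
Proof.
rewrite /deg -sum1_card big_mkcond; apply: eq_bigr => y _.
by rewrite !inE; case: (adj _ _ _).
Qed.

Lemma pair_eqE x y a c :
  ([set x; y] == [set a; c]) = (x == a) && (y == c) || (x == c) && (y == a).
Proof.
apply/eqP/idP => [E|/orP[]/andP[/eqP-> /eqP->] //]; last exact: setUC.
have Ez z : (z \in [set x; y]) = (z \in [set a; c]) by rewrite E.
have := Ez x; have := Ez y; have := Ez a; have := Ez c.
rewrite !inE !eqxx ?orbT /= !(eq_sym a) !(eq_sym c).
by case: (x == a); case: (y == a); case: (x == c); case: (y == c).
Qed.

Lemma sum_pair (g : V -> nat) x a c : a != c ->
  \sum_y ([set x; y] == [set a; c]) * g y = (x == a) * g c + (x == c) * g a.
Proof.
move=> ac; under eq_bigr => y _ do rewrite pair_eqE.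
have sum1 z : \sum_y (y == z) * g y = g z.
  rewrite (bigD1 z) //= eqxx mul1n big1 ?addn0 // => y /negbTE -> //.
case: (eqVneq x a) => [->|xa] /=.
  rewrite (negbTE ac) /= addn0 mul1n -sum1.
  by apply: eq_bigr => y _; rewrite orbF.
case: (eqVneq x c) => [_|xc] /=; first by rewrite mul1n sum1.
by rewrite big1.
Qed.

Lemma swap_exists G a b c d :
  uniq [:: a; b; c; d] -> adj G a c -> adj G b d -> ~~ adj G b c ->
  ~~ adj G a d -> exists G', is_swap a b c d G G'.
Proof.
move=> un ac bd bc ad.
pose E := (edges G :\: [set [set a; c]; [set b; d]])
                    :|: [set [set b; c]; [set a; d]].
have sE : [forall e in E, #|e| == 2].
  apply/forall_inP => e; rewrite !inE => /orP[/andP[_ eG]|].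
    by have /forall_inP/(_ _ eG) := edges_simple G.
  move: un; rewrite /= !inE !negb_or => /and4P[/and3P[? ? ?] /andP[? ?] ? _].
  by case/orP => /eqP ->; rewrite cards2; lia.
by exists (SGraph sE); rewrite /is_swap un ac bd bc ad /=.
Qed.

(** Deleted edges are added on the left and new edges on the right, so no subtraction occurs. The
    constant weight 1 gives degrees; the indicator of a degree gives spectra. *)
Lemma swap_sum (g : V -> nat) G G' a b c d x : is_swap a b c d G G' ->
  \sum_y adj G' x y * g y + ((x == a) * g c + (x == c) * g a) +
     ((x == b) * g d + (x == d) * g b) =
  \sum_y adj G x y * g y + ((x == b) * g c + (x == c) * g b) +
     ((x == a) * g d + (x == d) * g a).
Proof.
case/and5P=> un ac bd nbc /andP[nad /eqP E].
move: un; rewrite /= !inE !negb_or.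
move=> /and4P[/and3P[ab nac nad'] /andP[nbc' nbd] cd _].
rewrite -!sum_pair // -!big_split /=; apply: eq_bigr => y _.
rewrite -!mulnDl; congr (_ * _); rewrite /adj E !inE.
have h1 : ([set x; y] == [set a; c]) ==> ([set x; y] \in edges G).
  by apply/implyP => /eqP ->.
have h2 : ([set x; y] == [set b; d]) ==> ([set x; y] \in edges G).
  by apply/implyP => /eqP ->.
have h3 : ([set x; y] == [set b; c]) ==> ([set x; y] \notin edges G).
  by apply/implyP => /eqP ->.
have h4 : ([set x; y] == [set a; d]) ==> ([set x; y] \notin edges G).
  by apply/implyP => /eqP ->.
have h5 : ~~ (([set x; y] == [set a; c]) && ([set x; y] == [set b; d])).
  apply/negP => /andP[/eqP -> ].
  by rewrite pair_eqE (negbTE ab) (negbTE nad').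
have h6 : ~~ (([set x; y] == [set b; c]) && ([set x; y] == [set a; d])).
  apply/negP => /andP[/eqP -> ].
  by rewrite pair_eqE eq_sym (negbTE ab) (negbTE nbd).
(* For fixed [y] a Boolean identity remains: deleted pairs were edges, new pairs were not, and
   neither two deleted nor two new pairs coincide. *)
move: h1 h2 h3 h4 h5 h6.
by do 4!case: (_ == _); case: (_ \in _).
Qed.

Lemma swap_deg G G' a b c d u :
  is_swap a b c d G G' -> deg G' u = deg G u.
Proof.
have degM K : deg K u = \sum_y adj K u y * 1.
  by rewrite degE; apply: eq_bigr => y _; rewrite muln1.
by move=> sw; have := swap_sum (fun=> 1) u sw; rewrite -!degM; lia.
Qed.

(** Here the restriction on swaps matters: [c] and [d] trade neighbours of equal degree, so their
    own spectra do not change. *)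
Lemma swap_spectrum G G' a b c d u l :
  is_swap a b c d G G' -> deg G a = deg G b ->
  spectrum G' u l + (u == a) * (deg G c == l) + (u == b) * (deg G d == l) =
  spectrum G u l + (u == b) * (deg G c == l) + (u == a) * (deg G d == l).
Proof.
move=> sw dab; have := swap_sum (fun y => deg G y == l) u sw.
have -> : \sum_y adj G' u y * (deg G y == l) = spectrum G' u l.
  by rewrite spectrumE; apply: eq_bigr => y _; rewrite (swap_deg _ sw).
by rewrite -spectrumE dab; lia.
Qed.

(* Transposing [v] and [w] would otherwise embed the [i]-neighbours of [v] into
   those of [w], also when [v] and [w] are themselves adjacent. *)
Lemma private_neighbor G v w i :
  deg G v = deg G w -> spectrum G w i < spectrum G v i ->
  exists c, [/\ adj G v c, ~~ adj G w c, c != w & deg G c = i].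
Proof.
move=> dvw lt.
have [c|none] := pickP [pred c | [&& adj G v c, ~~ adj G w c, c != w &
                                     deg G c == i]].
  by case/and4P => ? ? ? /eqP ?; exists c.
suff: spectrum G v i <= spectrum G w i by rewrite leqNgt lt.
rewrite /spectrum -(card_imset _ (@perm_inj _ (tperm v w))).
apply: subset_leq_card; apply/subsetP => _ /imsetP[c + ->].
rewrite !inE => /andP[vc di].
case: tpermP => [cv|cw|cv /eqP cw].
- by rewrite cv adj_irr in vc.
- by rewrite adj_sym -cw vc dvw -cw.
- by have := none c; rewrite /= vc di cw !andbT => /negbFE.
Qed.

(** The swap trades a private neighbour [c] of [v], of degree [i], for a private neighbour [d] of
    [w], of degree [k]. *)
Lemma rso_exchange G v w i k :
  deg G v = deg G w -> spectrum G w i < spectrum G v i ->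
  spectrum G v k < spectrum G w k ->
  exists G', [/\ rso G G', forall u, deg G' u = deg G u &
    forall u l,
      spectrum G' u l + (u == v) * (i == l) + (u == w) * (k == l) =
      spectrum G u l + (u == w) * (i == l) + (u == v) * (k == l)].
Proof.
move=> dvw lti ltk.
have [c [vc nwc cw dc]] := private_neighbor dvw lti.
have [d [wd nvd dv dd]] := private_neighbor (esym dvw) ltk.
have [G' sw] : exists G', is_swap v w c d G G'.
  apply: swap_exists => //=; rewrite !inE !negb_or !andbT.
  have ne x y : adj G x y -> x != y.
    by move=> xy; apply: contraTneq xy => ->; rewrite adj_irr.
  rewrite (ne _ _ vc) (ne _ _ wd) /= (eq_sym v d) dv (eq_sym w c) cw !andbT /=.
  apply/andP; split; first by apply: contraTneq lti => ->; rewrite ltnn.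
  by apply: contraNneq nwc => ->.
exists G'; split.
- apply/existsP; exists v; apply/existsP; exists w.
  apply/existsP; exists c; apply/existsP; exists d.
  by rewrite dvw eqxx.
- by move=> u; apply: swap_deg sw.
- by move=> u l; rewrite -dc -dd; apply: swap_spectrum.
Qed.

(** * Row and column sums of the spectra *)

Lemma deg_lt_card G v : deg G v < #|V|.+1.
Proof. by rewrite ltnS max_card. Qed.

Lemma sum_spectrum G v : \sum_(i < #|V|.+1) spectrum G v i = deg G v.
Proof.
under eq_bigr => i _ do rewrite spectrumE.
rewrite exchange_big degE; apply: eq_bigr => y _ /=.
rewrite (bigD1 (Ordinal (deg_lt_card G y))) //= eqxx muln1 big1 ?addn0 // => i.
by rewrite -val_eqE /= eq_sym => /negbTE ->; rewrite muln0.
Qed.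

Lemma spectrum_large G v i : #|V| < i -> spectrum G v i = 0.
Proof.
move=> lt; rewrite spectrumE big1 // => y _.
by have := deg_lt_card G y; case: eqP => [->|]; [lia | rewrite muln0].
Qed.

(* For [i = j] each edge inside the class is seen from both its ends. *)
Lemma sum_spectrum_class G j i :
  \sum_(v | deg G v == j) spectrum G v i =
  if i == j then 2 * jdm G j j else jdm G i j.
Proof.
have sum1 (h : V -> nat) z : \sum_y (y == z) * h y = h z.
  by rewrite (bigD1 z) //= eqxx mul1n big1 ?addn0 // => y /negbTE ->.
(* [t e] counts the orientations of [e] from a vertex of degree [j] to one of degree [i]. *)
pose t (e : {set V}) :=
  \sum_v \sum_y ([set v; y] == e) * (deg G y == i) * (deg G v == j).
have -> : \sum_(v | deg G v == j) spectrum G v i = \sum_(e in edges G) t e.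
  rewrite exchange_big big_mkcond /=; apply: eq_bigr => v _.
  rewrite exchange_big spectrumE /=.
  have -> : (if deg G v == j then \sum_y adj G v y * (deg G y == i) else 0) =
      (\sum_y adj G v y * (deg G y == i)) * (deg G v == j).
    by case: eqP; rewrite ?muln1 ?muln0.
  rewrite !big_distrl /=; apply: eq_bigr => y _.
  rewrite -!big_distrl /=; congr (_ * _ * _).
  rewrite /adj; have [vy|vy] := boolP (_ \in _).
    rewrite (bigD1 _ vy) /= eqxx big1 // => e /andP[_].
    by rewrite eq_sym => /negbTE ->.
  by rewrite big1 // => e eG; case: eqP vy => // ->; rewrite eG.
have jdmE i' j' : jdm G i' j' = \sum_(e in edges G)
    [exists x in deg_class G i', exists y in deg_class G j', e == [set x; y]].
  rewrite /jdm -sum1_card big_mkcond [RHS]big_mkcond /=; apply: eq_bigr => e _.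
  by rewrite inE; case: (e \in _) => //=; case: ifP.
have tE e : e \in edges G -> t e = (if i == j then 2 else 1) *
    [exists x in deg_class G i, exists y in deg_class G j, e == [set x; y]].
  move=> eG; have /forall_inP/(_ _ eG)/cards2P[a [c [ac ->]]] := edges_simple G.
  rewrite /t; under eq_bigr => v _ do rewrite -big_distrl /= sum_pair // mulnDl
    -!mulnA.
  rewrite big_split /= !sum1.
  have -> : [exists x in deg_class G i, exists y in deg_class G j,
      [set a; c] == [set x; y]] =
      (deg G a == i) && (deg G c == j) || (deg G c == i) && (deg G a == j).
    apply/exists_inP/orP => [[x]|].
      rewrite inE => xi /exists_inP[y]; rewrite inE pair_eqE => yj.
      by case/orP => /andP[/eqP -> /eqP ->]; [left|right]; apply/andP.
    case=> /andP[xi yj]; [exists a | exists c]; rewrite ?inE //;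
      apply/exists_inP; [exists c | exists a]; rewrite ?inE //.
    by rewrite setUC.
  (* For [i = j] both orientations count or neither does; otherwise at most one does. *)
  case: (eqVneq i j) => [->|ij].
    by case: (deg G a == j); case: (deg G c == j).
  case: (eqVneq (deg G a) i) => [->|_]; case: (eqVneq (deg G c) i) => [->|_];
    by rewrite ?(negbTE ij) /= ?muln0 ?mul1n ?mul0n ?addn0 ?andbF ?orbF.
rewrite (eq_bigr _ tE) -big_distrr /= !jdmE.
by case: (eqVneq i j) => [->|]; rewrite ?mul1n.
Qed.

(** The ceiling exceeds the floor by at most one, and the floor is nonnegative, so its absolute
    value is the floor itself. *)
Lemma balanced_two_valued G v i : balanced G ->
  `|Num.floor (avg_deg G (deg G v) i)| <= spectrum G v i
    <= `|Num.floor (avg_deg G (deg G v) i)|.+1.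
Proof.
move=> /(_ (deg G v) v); rewrite inE eqxx => /(_ isT i).
have : (0 <= Num.floor (avg_deg G (deg G v) i))%R.
  by rewrite Num.Theory.floor_ge0 Num.Theory.divr_ge0 ?Num.Theory.ler0n.
rewrite Num.Theory.ceil_floor; move: (Num.floor _) => z.
by case: (_ \isn't a _); lia.
Qed.

End Graphs.

Theorem theorem1 (V : finType) (G H : sgraph V)
    (balG : balanced G) (balH : balanced H)
    (isoG : no_isolated G) (isoH : no_isolated H)
    (same_class : forall i : nat, deg_class G i = deg_class H i)
    (same_jdm : forall i j : nat, jdm G i j = jdm H i j) :
  exists s : seq (sgraph V),
    path (@rso V) G s /\
    forall (v : V) (i : nat), spectrum (last G s) v i = spectrum H v i.
Proof.
have degGH v : deg H v = deg G v.
  by have /setP/(_ v) := same_class (deg G v); rewrite !inE eqxx => /esym/eqP.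
have avgGH j i : avg_deg H j i = avg_deg G j i.
  by rewrite /avg_deg !same_jdm same_class.
pose I := 'I_#|V|.+1.
pose has_spectrum K (M : V -> I -> nat) :=
  (forall v, deg K v = deg G v) /\ (forall v (i : I), spectrum K v i = M v i).
(* Quantifying over all graphs with spectra [M] makes [reach] vacuous at matrices without a
   realization, so its closure properties can hold for arbitrary matrices. *)
pose reach M N := forall K, has_spectrum K M ->
  exists2 s, path (@rso V) K s & has_spectrum (last K s) N.
pose MG v (i : I) := spectrum G v i; pose MH v (i : I) := spectrum H v i.
have [s ps [_ es]] : exists2 s, path (@rso V) G s & has_spectrum (last G s) MH.
  suff /(_ G) : reach MG MH by apply.
  apply: (@compatible_reach _ I (deg G)
    (fun j (i : I) => `|Num.floor (avg_deg G j i)|)).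
  + move=> M N eMN K [dK sK]; exists [::] => //.
    by split=> // v i; rewrite -eMN.
  + move=> M N L rMN rNL K /rMN[s ps /rNL[s' ps' h]].
    by exists (s ++ s'); rewrite ?cat_path ?ps ?last_cat.
  + move=> M v w i k ex K [dK sK]; have [vw ik] := exchangeable_neq ex.
    have [dvw Mi Mk] := ex.
    have [|||K' [r dK' sK']] := @rso_exchange _ K v w i k.
    * by rewrite !dK.
    * by rewrite !sK Mi.
    * by rewrite !sK Mk.
    exists [:: K']; first by rewrite /= r.
    split=> [u|u l] /=; first by rewrite dK'.
    have := sK' u l; rewrite !sK /exchange !(eq_sym (nat_of_ord _) l) !val_eqE.
    case: (eqVneq l i) => [->|li].
      rewrite (negbTE ik) /=; case: tpermP => [->|->|/eqP uv /eqP uw].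
      - by rewrite eqxx (negbTE vw) Mi; lia.
      - by rewrite eqxx eq_sym (negbTE vw) Mi; lia.
      - by rewrite (negbTE uv) (negbTE uw); lia.
    case: (eqVneq l k) => [->|lk] /=; last by lia.
    case: tpermP => [->|->|/eqP uv /eqP uw].
    - by rewrite eqxx (negbTE vw) Mk; lia.
    - by rewrite eqxx eq_sym (negbTE vw) Mk; lia.
    - by rewrite (negbTE uv) (negbTE uw); lia.
  + split.
    * by move=> v i; apply: balanced_two_valued.
    * by move=> v i; rewrite -avgGH -degGH; apply: balanced_two_valued.
    * by move=> v; rewrite !sum_spectrum.
    * move=> j i; rewrite sum_spectrum_class !same_jdm -sum_spectrum_class.
      by apply: eq_bigl => v; rewrite degGH.
(* The matrices have columns only up to [#|V|]; beyond it both spectra vanish. *)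
exists s; split=> // v i; have [lt|ge] := ltnP i #|V|.+1.
  exact: es v (Ordinal lt).
by rewrite !spectrum_large.
Qed.
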